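(* Let $X$ be a pointed metric space and $E$ a Banach space over $\mathbb{K}$. For $1\leq p\leq\infty$, $d_p$ is a uniform and dualizable Lipschitz cross-norm on $X\boxtimes E$.
   Context: $\mathbb{K}$ is $\mathbb{R}$ or $\mathbb{C}$. A pointed metric space $X$ is a metric space (with metric $d$) with a distinguished base point $0$. For pointed metric spaces $X,Y$ (a Banach space being pointed by its zero vector), $\mathrm{Lip}_0(X,Y)$ is the set of all Lipschitz maps $f\colon X\to Y$ with $f(0)=0$, and $\mathrm{Lip}(f)$ is the least Lipschitz constant; $X^\#=\mathrm{Lip}_0(X,\mathbb{K})$, normed by $\mathrm{Lip}$, with closed unit ball $B_{X^\#}$. $E^*$ is the topological dual of $E$ and $\langle\phi,e\rangle=\phi(e)$; $V'$ denotes the algebraic dual of a vector space $V$; $\mathcal{L}(E;E)$ is the space of bounded linear operators on $E$. For $x,y\in X$ and $e\in E$, $\delta_{(x,y)}\boxtimes e\in \mathrm{Lip}_0(X,E^* )'$ is the linear functional $f\mapsto\langle f(x)-f(y),e\rangle$. The Lipschitz tensor product $X\boxtimes E$ is the linear subspace of $\mathrm{Lip}_0(X,E^* )'$ spanned by all the functionals $\delta_{(x,y)}\boxtimes e$ with $x,y\in X$, $e\in E$. Every $u\in X\boxtimes E$ can be written (non-uniquely) as $u=\sum_{i=1}^n\delta_{(x_i,y_i)}\boxtimes e_i$. For $e_1,\dots,e_n\in E$ put $\|(e_1,\dots,e_n)\|_p=\left(\sum_{i=1}^n\|e_i\|^p\right)^{1/p}$ if $1\leq p<\infty$ and $\|(e_1,\dots,e_n)\|_\infty=\max_{1\leq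 i\leq n}\|e_i\|$. For $x_i,y_i\in X$ and $\lambda_i\in\mathbb{R}^+$ (positive reals), $1\leq i\leq n$, put $$\|(\lambda_1\delta_{(x_1,y_1)},\dots,\lambda_n\delta_{(x_n,y_n)})\|_p^{Lw}=\sup_{g\in B_{X^\#}}\left(\sum_{i=1}^n\lambda_i^p|g(x_i)-g(y_i)|^p\right)^{1/p}\ (1\leq p<\infty),$$ $$\|(\lambda_1\delta_{(x_1,y_1)},\dots,\lambda_n\delta_{(x_n,y_n)})\|_\infty^{Lw}=\sup_{g\in B_{X^\#}}\max_{1\leq i\leq n}\lambda_i|g(x_i)-g(y_i)|.$$ Let $p'$ be the conjugate index of $p$ ($p'=p/(p-1)$ for $1<p<\infty$, $p'=\infty$ for $p=1$, $p'=1$ for $p=\infty$). The Lipschitz $p$-nuclear norm of $u\in X\boxtimes E$ is $$d_p(u)=\inf\left\{\|(\lambda_1\delta_{(x_1,y_1)},\dots,\lambda_n\delta_{(x_n,y_n)})\|_{p'}^{Lw}\,\|(e_1,\dots,e_n)\|_p\colon u=\sum_{i=1}^n\lambda_i\delta_{(x_i,y_i)}\boxtimes e_i\right\},$$ the infimum being over all such representations of $u$ with $\lambda_i\in\mathbb{R}^+$, where $\lambda\delta_{(x,y)}\boxtimes e=\lambda(\delta_{(x,y)}\boxtimes e)$. A norm $\alpha$ on $X\boxtimes E$ is a Lipschitz cross-norm if $\alpha(\delta_{(x,y)}\boxtimes e)=d(x,y)\|e\|$ for all $x,y\in X$, $e\in E$. A Lipschitz cross-norm $\alpha$ is dualizable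 if for all $g\in X^\#$, $\phi\in E^*$ and all $\sum_{i=1}^n\delta_{(x_i,y_i)}\boxtimes e_i\in X\boxtimes E$, $\left|\sum_{i=1}^n(g(x_i)-g(y_i))\langle\phi,e_i\rangle\right|\leq\mathrm{Lip}(g)\|\phi\|\,\alpha\left(\sum_{i=1}^n \delta_{(x_i,y_i)}\boxtimes e_i\right)$. It is uniform if for all $h\in\mathrm{Lip}_0(X,X)$, $T\in\mathcal{L}(E;E)$ and all $\sum_{i=1}^n\delta_{(x_i,y_i)}\boxtimes e_i\in X\boxtimes E$, $\alpha\left(\sum_{i=1}^n\delta_{(h(x_i),h(y_i))}\boxtimes T(e_i)\right)\leq\mathrm{Lip}(h)\|T\|\,\alpha\left(\sum_{i=1}^n \delta_{(x_i,y_i)}\boxtimes e_i\right)$. *)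

(* Defs.v *)
From HB Require Import structures.
From mathcomp Require Import all_boot all_order all_algebra.
From mathcomp Require Import complex.
From mathcomp Require Import all_classical all_reals all_analysis.

Set Implicit Arguments.
Unset Strict Implicit.
Unset Printing Implicit Defensive.

Import Order.TTheory GRing.Theory Num.Theory.
Import numFieldNormedType.Exports.

Local Open Scope classical_set_scope.
Local Open Scope ring_scope.

Inductive scalar_kind := RealScalars | ComplexScalars.

Definition scalar_field (R : realType) (k : scalar_kind) : numFieldType :=
  match k with RealScalars => R | ComplexScalars => R[i]%C end.

Definition of_real (R : realType) (k : scalar_kind) : R -> scalar_field R k :=
  match k with
  | RealScalars => fun x => x
  | ComplexScalars => fun x => x%:C%C
  end.

Definition real_part (R : realType) (k : scalar_kind) : scalar_field R k -> R :=
  match k with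
  | RealScalars => fun x => x
  | ComplexScalars => fun z => complex.Re z
  end.

(* The norm of a [normedModType K] takes its values in K; when K = R[i] they
   are nonnegative, hence real, and [rnorm] reads them in R. *)
Definition rnorm (R : realType) (k : scalar_kind)
  (V : normedModType (scalar_field R k)) (v : V) : R := real_part `|v|.

Section real_part_theory.
Variables (R : realType) (k : scalar_kind).
Local Notation K := (scalar_field R k).

Lemma real_part_of_real (x : R) : real_part (of_real k x) = x.
Proof. by case: (k). Qed.

Lemma real_partK (x : K) : x \is Num.real -> of_real k (real_part x) = x.
Proof.
case: (k) x => //= -[a b]; rewrite realE !lecE /= (eq_sym 0) -andb_orr.
by case/andP => /eqP ->.
Qed.

Lemma real_part0 : real_part (0 : K) = 0.
Proof. by case: (k). Qed.

Lemma real_part1 : real_part (1 : K) = 1.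
Proof. by case: (k). Qed.

Lemma real_partD (x y : K) : real_part (x + y) = real_part x + real_part y.
Proof. by case: (k) x y => //= -[? ?] [? ?]. Qed.

Lemma real_partM (x y : K) : x \is Num.real ->
  real_part (x * y) = real_part x * real_part y.
Proof.
case: (k) x y => //= -[a b] [c d]; rewrite realE !lecE /=.
by rewrite (eq_sym 0) -andb_orr => /andP[/eqP -> _]; rewrite mul0r subr0.
Qed.

Lemma le_real_part (x y : K) : x <= y -> real_part x <= real_part y.
Proof. by case: (k) x y => //= -[? ?] [? ?]; rewrite lecE => /andP[]. Qed.

Variable V : normedModType K.

Lemma rnorm_ge0 (v : V) : 0 <= rnorm v.
Proof. by rewrite -real_part0 le_real_part. Qed.

Lemma rnorm0 : rnorm (0 : V) = 0.
Proof. by rewrite /rnorm normr0 real_part0. Qed.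

Lemma rnormN (v : V) : rnorm (- v) = rnorm v.
Proof. by rewrite /rnorm normrN. Qed.

Lemma ler_rnormD (u v : V) : rnorm (u + v) <= rnorm u + rnorm v.
Proof. by rewrite -real_partD le_real_part// ler_normD. Qed.

Lemma rnormZ (a : K) (v : V) : rnorm (a *: v) = rnorm (a : K^o) * rnorm v.
Proof. by rewrite /rnorm normrZ real_partM// normr_real. Qed.

Lemma rnorm_eq0 (v : V) : rnorm v = 0 -> v = 0.
Proof.
move=> v0; apply/eqP; rewrite -normr_eq0; apply/eqP.
by rewrite -(real_partK (normr_real v)) -[real_part _]/(rnorm v) v0; case: (k).
Qed.

End real_part_theory.

Record submod (K : pzRingType) (V : lmodType K) (S : submodClosed V) :=
  Submod { submod_val :> V ; _ : submod_val \in S }.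

HB.instance Definition _ (K : pzRingType) (V : lmodType K)
  (S : submodClosed V) := [isSub of submod S for @submod_val K V S].
HB.instance Definition _ (K : pzRingType) (V : lmodType K)
  (S : submodClosed V) := [Choice of submod S by <:].
HB.instance Definition _ (K : pzRingType) (V : lmodType K)
  (S : submodClosed V) := [SubChoice_isSubLmodule of submod S by <:].

Section submod_theory.
Variables (K : pzRingType) (V : lmodType K) (S : submodClosed V).

Lemma submod_valD (u v : submod S) :
  submod_val (u + v) = submod_val u + submod_val v.
Proof. by []. Qed.

Lemma submod_valZ (a : K) (u : submod S) :
  submod_val (a *: u) = a *: submod_val u.
Proof. by []. Qed.

Lemma submod_val_sum (n : nat) (u : 'I_n -> submod S) :
  submod_val (\sum_(i < n) u i) = \sum_(i < n) submod_val (u i).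
Proof. by elim/big_rec2: _ => // i w z _ <-. Qed.

End submod_theory.

Section algebraic_dual.
Variables (K : comNzRingType) (V : lmodType K).

Definition linear_form : {pred V -> K^o} := [pred f : V -> K^o | `[< linear f >]].

Lemma linear_form_submod_closed : submod_closed linear_form.
Proof.
split=> [|a f g]; rewrite !inE.
  by move=> b u v; rewrite /= scaler0 addr0.
move=> lf lg b u v.
rewrite -[LHS]/(a *: f _ + g _) -[RHS]/(b *: (a *: f u + g u) + (a *: f v + g v)).
rewrite lf lg !scalerDr !scalerA (mulrC a) -!addrA; congr (_ + _).
by rewrite addrCA.
Qed.

HB.instance Definition _ :=
  GRing.isSubmodClosed.Build K (V -> K^o) linear_form linear_form_submod_closed.

Definition alg_dual := submod linear_form.
HB.instance Definition _ := GRing.Lmodule.on alg_dual.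

End algebraic_dual.

Section linear_span.
Variables (K : pzRingType) (V : lmodType K) (A : set V).

Definition lin_span : {pred V} := [pred v : V | `[< exists (n : nat)
  (c : 'I_n -> K) (a : 'I_n -> V),
  (forall i, A (a i)) /\ v = \sum_(i < n) c i *: a i >]].

Lemma lin_span_submod_closed : submod_closed lin_span.
Proof.
split=> [|s u v]; rewrite !inE.
  exists 0%N, (fun=> 0), (fun=> 0).
  by split=> [[]//|]; rewrite big_ord0.
move=> [n [c [a [Aa ->]]]] [m [d [b [Ab ->]]]]; exists (n + m)%N.
exists (fun i => match fintype.split i with inl j => s * c j | inr j => d j end).
exists (fun i => match fintype.split i with inl j => a j | inr j => b j end).
split=> [i|]; first by case: fintype.split.
rewrite big_split_ord /= scaler_sumr; congr (_ + _); apply: eq_bigr => i _.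
  by rewrite (unsplitK (inl i)) scalerA.
by rewrite (unsplitK (inr i)).
Qed.

HB.instance Definition _ :=
  GRing.isSubmodClosed.Build K V lin_span lin_span_submod_closed.

Lemma mem_lin_span (v : V) : A v -> v \in lin_span.
Proof.
move=> Av; rewrite inE.
by exists 1%N, (fun=> 1), (fun=> v); split=> //; rewrite big_ord1 scale1r.
Qed.

End linear_span.

Definition opnorm (R : realType) (k : scalar_kind)
    (V W : normedModType (scalar_field R k)) (T : V -> W) : R :=
  sup [set rnorm (T v) | v in [set v : V | rnorm v <= 1]].

Section topological_dual.
Variables (R : realType) (k : scalar_kind) (E : normedModType (scalar_field R k)).
Local Notation K := (scalar_field R k).

Definition cont_linear_form : {pred E -> K^o} :=
  [pred f : E -> K^o | `[< linear f /\ continuous f >]].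

Lemma cont_linear_form_submod_closed : submod_closed cont_linear_form.
Proof.
split=> [|a f g]; rewrite !inE.
  split=> [b u v /=|x]; first by rewrite scaler0 addr0.
  exact: (@cst_continuous E K^o 0).
move=> [lf cf] [lg cg]; split.
  by have [_ /(_ a f g)] := @linear_form_submod_closed K E; rewrite !inE; exact.
move=> x; apply: (@continuousD K K^o E); last exact: cg.
by apply: continuousZr; exact: cf.
Qed.

HB.instance Definition _ := GRing.isSubmodClosed.Build K (E -> K^o)
  cont_linear_form cont_linear_form_submod_closed.

Definition cont_dual := submod cont_linear_form.
HB.instance Definition _ := GRing.Lmodule.on cont_dual.

Definition pairing (phi : cont_dual) (e : E) : K := submod_val phi e.

Definition dual_norm (phi : cont_dual) : R := opnorm (submod_val phi).

Lemma dualP (phi : cont_dual) : linear (submod_val phi) /\ continuous (submod_val phi).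
Proof. by case: phi => f /=; rewrite inE. Qed.

Lemma dual_has_sup (phi : cont_dual) : has_sup
  [set rnorm (submod_val phi v) | v in [set v : E | rnorm v <= 1]].
Proof.
have [lphi cphi] := dualP phi.
split; first by exists (rnorm (submod_val phi 0)), 0; rewrite //= rnorm0 ler01.
pose f : {linear E -> K^o} :=
  HB.pack (submod_val phi) (GRing.isLinear.Build _ _ _ _ _ lphi).
have /linear_boundedP[M [Mr MP]] : bounded_near f (nbhs 0).
  by apply: (@continuous_linear_bounded K E K^o 0 f); exact: cphi.
have r0 : 0 <= `|M| + 1 by rewrite addr_ge0.
have ltM : M < `|M| + 1 by rewrite ltr_pwDr// real_ler_norm.
exists (real_part (`|M| + 1)) => _ [v /= v1 <-].
have := MP _ ltM v; move=> /le_real_part /le_trans; apply.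
rewrite real_partM ?ger0_real// ler_piMr//.
by rewrite -(@real_part0 R k) le_real_part.
Qed.

Lemma dual_norm_ge (phi : cont_dual) (e : E) :
  rnorm e <= 1 -> rnorm (pairing phi e : K^o) <= dual_norm phi.
Proof.
by move=> e1; apply: sup_upper_bound; [exact: dual_has_sup|exists e].
Qed.

Lemma dual_norm_le (phi : cont_dual) (M : R) :
  (forall e, rnorm e <= 1 -> rnorm (pairing phi e : K^o) <= M) ->
  dual_norm phi <= M.
Proof.
move=> phiM; apply: ge_sup; first by have [] := dual_has_sup phi.
by move=> _ [e /= e1 <-]; exact: phiM.
Qed.

Lemma dual_norm0 : dual_norm 0 = 0.
Proof.
apply/le_anti/andP; split.
  by apply: dual_norm_le => e _; rewrite [pairing _ _]/(0 : K^o) rnorm0.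
have := @dual_norm_ge 0 0; rewrite [pairing _ _]/(0 : K^o) !rnorm0.
by apply; exact: ler01.
Qed.

Lemma ler_dual_normD (phi psi : cont_dual) :
  dual_norm (phi + psi) <= dual_norm phi + dual_norm psi.
Proof.
apply: dual_norm_le => e e1; apply: (le_trans (ler_rnormD _ _)).
by rewrite lerD// dual_norm_ge.
Qed.

Lemma dual_normZ_le (a : K) (phi : cont_dual) :
  dual_norm (a *: phi) <= rnorm (a : K^o) * dual_norm phi.
Proof.
apply: dual_norm_le => e e1.
rewrite [pairing _ _]/(a *: (pairing phi e : K^o)) rnormZ.
by rewrite ler_wpM2l ?rnorm_ge0// dual_norm_ge.
Qed.

End topological_dual.

Section lipschitz.
Variables (R : realType) (X Y : Type) (dX : X -> X -> R) (dY : Y -> Y -> R).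

Definition lip_bound (f : X -> Y) : set R :=
  [set L | 0 <= L /\ forall x y, dY (f x) (f y) <= L * dX x y].

(* For a Lipschitz f this infimum is attained: it is the least Lipschitz
   constant. *)
Definition Lip (f : X -> Y) : R := inf (lip_bound f).

Definition Lip0 (x0 : X) (y0 : Y) : set (X -> Y) :=
  [set f | lip_bound f !=set0 /\ f x0 = y0].

End lipschitz.

Section lipschitz_spaces.
Variables (R : realType) (k : scalar_kind) (X : metricType R) (x0 : X).
Variable E : normedModType (scalar_field R k).
Local Notation K := (scalar_field R k).

Definition scalar_dist (a b : K) : R := rnorm (a - b : K^o).

Definition dual_dist (phi psi : cont_dual E) : R := dual_norm (phi - psi).

Definition lip_dual : set (X -> K) := Lip0 mdist scalar_dist x0 0.

Definition lip_dual_ball : set (X -> K) :=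
  lip_dual `&` [set g | Lip mdist scalar_dist g <= 1].

Definition Lip0_dual : {pred X -> cont_dual E} :=
  [pred f | `[< Lip0 mdist dual_dist x0 0 f >]].

Lemma Lip0_dual_submod_closed : submod_closed Lip0_dual.
Proof.
split=> [|a f g]; rewrite !inE.
  split=> //; exists 0; split=> // x y.
  by rewrite /dual_dist subrr dual_norm0 mul0r.
move=> [[L [L0 fL]] f0] [[M [M0 gM]] g0]; split; last first.
  by rewrite [LHS]/(a *: f x0 + g x0) f0 g0 scaler0; exact: addr0.
exists (rnorm (a : K^o) * L + M).
split=> [|x y]; first by rewrite addr_ge0// mulr_ge0// rnorm_ge0.
rewrite /dual_dist [_ - _](_ : _ = a *: (f x - f y) + (g x - g y)); last first.
  by rewrite scalerBr addrACA -opprD.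
rewrite mulrDl -mulrA; apply: (le_trans (ler_dual_normD _ _)).
rewrite lerD ?gM//; apply: (le_trans (dual_normZ_le _ _)).
by rewrite ler_wpM2l ?rnorm_ge0// fL.
Qed.

HB.instance Definition _ := GRing.isSubmodClosed.Build K (X -> cont_dual E)
  Lip0_dual Lip0_dual_submod_closed.

Definition lip_maps := submod Lip0_dual.
HB.instance Definition _ := GRing.Lmodule.on lip_maps.

Definition delta_fun (x y : X) (e : E) (f : lip_maps) : K^o :=
  pairing (submod_val f x - submod_val f y) e.

Lemma delta_fun_linear (x y : X) (e : E) : delta_fun x y e \in @linear_form K lip_maps.
Proof.
rewrite inE => a f g.
rewrite /delta_fun [submod_val (a *: f + g) x - _](_ : _ =
  a *: (submod_val f x - submod_val f y) + (submod_val g x - submod_val g y)) //.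
by rewrite scalerBr addrACA -opprD.
Qed.

Definition delta_form (x y : X) (e : E) : alg_dual lip_maps :=
  Submod (delta_fun_linear x y e).

Definition delta_forms : set (alg_dual lip_maps) :=
  [set u | exists x y e, u = delta_form x y e].

Definition lip_tensor := submod (lin_span delta_forms).
HB.instance Definition _ := GRing.Lmodule.on lip_tensor.

Lemma delta_form_span (x y : X) (e : E) : delta_form x y e \in lin_span delta_forms.
Proof. by apply: mem_lin_span; exists x, y, e. Qed.

Definition lip_delta (x y : X) (e : E) : lip_tensor := Submod (delta_form_span x y e).

Lemma lip_tensor_ext (u v : lip_tensor) :
  (forall f, submod_val (submod_val u) f = submod_val (submod_val v) f) -> u = v.
Proof. by move=> uv; do 2 apply: val_inj; apply/funext; exact: uv. Qed.

Lemma lip_tensor_sumE (n : nat) (a : 'I_n -> K) (x y : 'I_n -> X)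
    (e : 'I_n -> E) (f : lip_maps) :
  submod_val (submod_val (\sum_(i < n) a i *: lip_delta (x i) (y i) (e i))) f =
  \sum_(i < n) a i * pairing (submod_val f (x i) - submod_val f (y i)) (e i).
Proof.
rewrite !submod_val_sum fct_sumE; apply: eq_bigr => i _; rewrite submod_valZ.
transitivity (submod_val (a i *: delta_form (x i) (y i) (e i)) f).
  exact: erefl.
by rewrite submod_valZ; exact: erefl.
Qed.

(* Meant for 1 <= p and a nonnegative family a, so that the maximum may start
   from 0; the value at p = -oo is a dummy. *)
Definition lp_norm (p : \bar R) (n : nat) (a : 'I_n -> R) : R :=
  match p with
  | r%:E%E => (\sum_(i < n) a i `^ r) `^ r^-1
  | +oo%E => \big[Num.max/0]_(i < n) a i
  | -oo%E => 0
  end.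

Definition lip_weak_norm (p : \bar R) (n : nat) (l : 'I_n -> R)
    (x y : 'I_n -> X) : R :=
  sup [set lp_norm p (fun i => l i * scalar_dist (g (x i)) (g (y i)))
      | g in lip_dual_ball].

Definition nuclear_norm (p : \bar R) (u : lip_tensor) : R :=
  inf [set r | exists (n : nat) (l : 'I_n -> R) (x y : 'I_n -> X) (e : 'I_n -> E),
    [/\ (0 < n)%N, forall i, 0 < l i,
        u = \sum_(i < n) of_real k (l i) *: lip_delta (x i) (y i) (e i) &
        r = lip_weak_norm (hoelder_conjugate p) l x y *
            lp_norm p (fun i => rnorm (e i))]].

Definition is_norm (V : lmodType K) (alpha : V -> R) : Prop :=
  [/\ forall u, 0 <= alpha u,
      forall u, alpha u = 0 -> u = 0,
      forall (a : K) u, alpha (a *: u) = rnorm (a : K^o) * alpha u &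
      forall u v, alpha (u + v) <= alpha u + alpha v].

Definition is_lip_cross_norm (alpha : lip_tensor -> R) : Prop :=
  is_norm alpha /\ forall x y e, alpha (lip_delta x y e) = mdist x y * rnorm e.

Definition is_dualizable (alpha : lip_tensor -> R) : Prop :=
  forall (g : X -> K) (phi : cont_dual E) (n : nat) (x y : 'I_n -> X) (e : 'I_n -> E),
    lip_dual g ->
    rnorm (\sum_(i < n) (g (x i) - g (y i)) * pairing phi (e i) : K^o) <=
    Lip mdist scalar_dist g * dual_norm phi *
      alpha (\sum_(i < n) lip_delta (x i) (y i) (e i)).

Definition is_uniform (alpha : lip_tensor -> R) : Prop :=
  forall (h : X -> X) (T : {linear E -> E}) (n : nat)
      (x y : 'I_n -> X) (e : 'I_n -> E),
    Lip0 mdist mdist x0 x0 h -> bounded_near T (nbhs (0 : E)) ->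
    alpha (\sum_(i < n) lip_delta (h (x i)) (h (y i)) (T (e i))) <=
    Lip mdist mdist h * opnorm T * alpha (\sum_(i < n) lip_delta (x i) (y i) (e i)).

End lipschitz_spaces.

Arguments nuclear_norm {R k X} x0 E p u.

(* Main.v *)
From HB Require Import structures.
Require Import Defs.
From mathcomp Require Import all_boot all_order all_algebra.
From mathcomp Require Import complex ring lra.
From mathcomp Require Import all_classical all_reals all_analysis.

(** Everything is an estimate on a single representation of [u] as the sum of
the [l i *: delta (x i) (y i) (e i)], followed by an infimum.

Pairing [u] with the rank-one map [x |-> g x *: phi] gives the sum of the
[l i * (g (x i) - g (y i)) * phi (e i)].  Hoelder's inequality for the weights
[l i * |g (x i) - g (y i)|] and [|e i|] bounds it by
[Lip g * |phi| * nuclear_norm u] ([tensor_eval_rank_one_le]): this is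
dualizability.  Two other axioms follow from it.

- Definiteness.  If [nuclear_norm u = 0], then [u] vanishes on all rank-one
  maps.  On the finitely many points of a representation, every Lipschitz map
  [f] into the dual coincides with a finite sum of rank-one maps, built from
  Lipschitz bumps ([lip_maps_interpolation]); hence [u = 0] ([tensor_eq0]).

- The lower bound [d x y * |e| <= nuclear_norm (delta x y e)].  Test with the
  function [d(., y) - d(x0, y)] and with a functional norming [e].  The latter
  comes from the Hahn-Banach theorem, proved here for real and complex scalars
  by looking at minimal sublinear functionals ([hahn_banach]).

The triangle inequality rests on the freedom to move a factor between the [l i]
and the [e i].  If [nuclear_norm u < s], a representation can be rescaled so
that its weak factor is at most [s^(1/p')] and its strong factor at most
[s^(1/p)] ([nuclear_norm_lt]); concatenating such representations for [s] and
[t] gives the factors [(s + t)^(1/p')] and [(s + t)^(1/p)], whose product is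
[s + t].

For uniformity, [(h, T)] acts on representations term by term.  This is
well defined on [u] because the new functional evaluated at [f] is [u] evaluated
at [T^* o f o h] ([pullback]), again a Lipschitz map vanishing at the base
point.  The weak factor is multiplied by at most [Lip h], since [g o h] has
Lipschitz constant at most [Lip h] for [g] in the unit ball, and the strong one
by at most [|T|]. *)

Set Implicit Arguments.
Unset Strict Implicit.
Unset Printing Implicit Defensive.

Import Order.TTheory GRing.Theory Num.Theory.
Import numFieldNormedType.Exports.

Local Open Scope classical_set_scope.
Local Open Scope ring_scope.

(** * Real numbers inside the scalar field *)

Section real_scalars.
Variables (R : realType) (k : scalar_kind).
Local Notation K := (scalar_field R k).

Lemma of_real0 : of_real k (0 : R) = 0.
Proof. by case: (k). Qed.

Lemma of_real1 : of_real k (1 : R) = 1.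
Proof. by case: (k). Qed.

Lemma of_realD (a b : R) : of_real k (a + b) = of_real k a + of_real k b.
Proof. by case: (k) => //=; rewrite rmorphD. Qed.

Lemma of_realB (a b : R) : of_real k (a - b) = of_real k a - of_real k b.
Proof. by case: (k) => //=; rewrite rmorphB. Qed.

Lemma of_realM (a b : R) : of_real k (a * b) = of_real k a * of_real k b.
Proof. by case: (k) => //=; rewrite rmorphM. Qed.

Lemma rnorm_of_real (a : R) : rnorm (of_real k a : K^o) = `|a|.
Proof.
rewrite /rnorm; case: (k) => //=.
by rewrite expr0n /= addr0 sqrtr_sqr.
Qed.

Lemma rnormM (a b : K) :
  rnorm (a * b : K^o) = rnorm (a : K^o) * rnorm (b : K^o).
Proof. exact: (@rnormZ R k K^o a b). Qed.

Lemma ler_real_part_rnorm (a : K) : real_part a <= rnorm (a : K^o).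
Proof.
rewrite /rnorm; case: (k) a => /= [a|a]; first exact: ler_norm.
apply: (le_trans (ler_norm _)).
by have := normc_ge_Re a; rewrite lecE /= => /andP[_].
Qed.

Lemma ler_rnorm_sum (V : normedModType K) (n : nat) (F : 'I_n -> V) :
  rnorm (\sum_(i < n) F i) <= \sum_(i < n) rnorm (F i).
Proof.
elim/big_ind2: _ => [|x1 x2 y1 y2 le1 le2|//]; first by rewrite rnorm0.
by rewrite (le_trans (ler_rnormD _ _))// lerD.
Qed.

Lemma rnorm_of_realZ (V : normedModType K) (t : R) (v : V) :
  0 <= t -> rnorm (of_real k t *: v) = t * rnorm v.
Proof. by move=> t0; rewrite rnormZ rnorm_of_real ger0_norm. Qed.

Lemma ler_of_real (a b : R) : a <= b -> of_real k a <= of_real k b.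
Proof. by case: (k) => //= ab; rewrite lecR. Qed.

Lemma ler_norm_rnorm (V W : normedModType K) (v : V) (w : W) :
  rnorm v <= rnorm w -> `|v| <= `|w|.
Proof. by move=> /ler_of_real; rewrite !real_partK ?normr_real. Qed.

End real_scalars.

Section bounds.
Variable R : realType.

Lemma le_mul_inf (A : set R) (c m : R) : A !=set0 -> 0 <= c ->
  (forall a, A a -> m <= c * a) -> m <= c * inf A.
Proof.
move=> A0; rewrite le_eqVlt => /predU1P[<- mA|c0 mA].
  by have [a /mA] := A0; rewrite !mul0r.
rewrite mulrC -ler_pdivrMr//; apply: lb_le_inf => // a /mA.
by rewrite ler_pdivrMr// mulrC.
Qed.

End bounds.

(** * The Hahn-Banach theorem *)

Section hahn_banach.
Variables (R : realType) (k : scalar_kind) (V : lmodType (scalar_field R k)).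
Implicit Types (m q : V -> R) (t : R).

(** Positive homogeneity is asked only as an inequality, which is easier to check
and implies the equality, by [sublinearZ].  Only real scalars act, so that the
real and complex cases are treated together. *)
Definition sublinear m := (forall u v, m (u + v) <= m u + m v) /\
  (forall t v, 0 <= t -> m (of_real k t *: v) <= t * m v).

Lemma sublinear0 m : sublinear m -> m 0 = 0.
Proof.
move=> [mD mZ]; apply/le_anti/andP; split.
  by have := mZ 0 0 (lexx _); rewrite scaler0 mul0r.
by have := mD 0 0; rewrite addr0; lra.
Qed.

Lemma sublinearZ m t v : sublinear m -> 0 <= t ->
  m (of_real k t *: v) = t * m v.
Proof.
move=> ml; rewrite le_eqVlt => /predU1P[<-|t0].
  by rewrite of_real0 scale0r mul0r sublinear0.
apply/le_anti/andP; split; first by apply: ml.2; exact: ltW.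
rewrite mulrC -ler_pdivlMr// mulrC.
have := ml.2 t^-1 (of_real k t *: v).
rewrite scalerA -of_realM mulVf ?gt_eqF// of_real1 scale1r.
by rewrite invr_ge0 ltW //; exact.
Qed.

Lemma sublinear_ge m v : sublinear m -> - m (- v) <= m v.
Proof.
move=> ml; have := ml.1 v (- v).
by rewrite subrr (sublinear0 ml); lra.
Qed.

(** For sublinear [m], the largest sublinear functional below [m] whose value at [- v] is at most
[- m v].  A minimal [m] cannot be lowered in this way, which forces
[m x + m v <= m (x + v)], that is, additivity. *)
Definition dip m v : V -> R := fun x =>
  inf [set m (x + of_real k t *: v) - t * m v | t in [set t : R | 0 <= t]].

Section dip_theory.
Variables (m : V -> R) (v : V).
Hypothesis ml : sublinear m.

Lemma dip_lb x : has_lbound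
  [set m (x + of_real k t *: v) - t * m v | t in [set t : R | 0 <= t]].
Proof.
exists (- m (- x)) => _ [t /= t0 <-].
have := ml.1 (x + of_real k t *: v) (- x).
by rewrite addrAC subrr add0r (sublinearZ _ ml t0); lra.
Qed.

Lemma dip_le x t : 0 <= t -> dip m v x <= m (x + of_real k t *: v) - t * m v.
Proof. by move=> t0; apply: ge_inf; [exact: dip_lb|exists t]. Qed.

Lemma dip_ge x a :
  (forall t, 0 <= t -> a <= m (x + of_real k t *: v) - t * m v) ->
  a <= dip m v x.
Proof.
move=> am; apply: lb_le_inf; last by move=> _ [t /= t0 <-]; exact: am.
by exists (m (x + of_real k 0 *: v) - 0 * m v), 0 => //=.
Qed.

Lemma dip_le_self x : dip m v x <= m x.
Proof.
by have := dip_le x (lexx 0); rewrite of_real0 scale0r addr0 mul0r subr0.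
Qed.

Lemma sublinear_dip : sublinear (dip m v).
Proof.
split=> [x y|s x s0].
  rewrite -lerBlDr; apply: dip_ge => t t0.
  rewrite lerBlDl -lerBlDr; apply: dip_ge => s s0.
  rewrite lerBlDr; apply: (le_trans (dip_le _ (addr_ge0 s0 t0))).
  have := ml.1 (y + of_real k s *: v) (x + of_real k t *: v).
  rewrite addrACA -scalerDl -of_realD (addrC y); lra.
apply: le_mul_inf => //.
  by exists (m (x + of_real k 0 *: v) - 0 * m v), 0 => //=.
move=> _ [t /= t0 <-]; apply: (le_trans (dip_le _ (mulr_ge0 s0 t0))).
by rewrite of_realM -scalerA -scalerDr (sublinearZ _ ml s0) mulrBr mulrA.
Qed.

End dip_theory.

(** Zorn's lemma applies because the pointwise infimum of a chain is again
sublinear: it is finite, as [m v >= - m (- v) >= - q (- v)], and for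
subadditivity the two members of the chain that nearly attain the infimum at [x]
and at [y] are comparable, so the smaller one serves at both points. *)
Lemma minimal_sublinear q : sublinear q ->
  exists m, [/\ sublinear m, forall v, m v <= q v &
    forall m', sublinear m' -> (forall v, m' v <= m v) -> m' = m].
Proof.
move=> ql.
pose below_q (m : V -> R) := sublinear m /\ forall v, m v <= q v.
pose T := {m | below_q m}.
pose below (s t : T) := `[< forall v, sval t v <= sval s v >].
have [||||[m [ml mq]] mmin] := @Zorn T below.
- by move=> t; apply/asboolP.
- move=> r s t /asboolP rs /asboolP st; apply/asboolP => v.
  exact: le_trans (st v) (rs v).
- move=> [s Ps] [t Pt] /asboolP /= st /asboolP /= ts; apply: eq_exist.
  by apply/funext => v; apply/le_anti/andP.
- move=> A totA; have [[a Aa]|A0] := pselect (A !=set0); last first.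
    exists (exist below_q q (conj ql (fun v => lexx _))) => s As.
    by case: A0; exists s.
  pose vals v := [set sval s v | s in A].
  have vals0 v : vals v !=set0 by exists (sval a v), a.
  have valsb v : has_lbound (vals v).
    exists (- q (- v)) => _ [[s [sl sq]] /= As <-].
    by apply: le_trans (sublinear_ge v sl); rewrite lerN2.
  have le_vals s v : A s -> inf (vals v) <= sval s v.
    by move=> As; apply: ge_inf => //; exists s.
  have infl : sublinear (fun v => inf (vals v)).
    split=> [x y|t v t0]; last first.
      apply: le_mul_inf => // _ [s As <-]; apply: (le_trans (le_vals s _ As)).
      by case: s As => s [[_ sZ] _] /= _; exact: sZ.
    rewrite -lerBlDr; apply: lb_le_inf => // _ [s As <-].
    rewrite lerBlDl -lerBlDr; apply: lb_le_inf => // _ [t At <-].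
    rewrite lerBlDr.
    have [/asboolP st|/asboolP ts] := totA s t As At.
      apply: (le_trans (le_vals t _ At)).
      apply: (le_trans ((svalP t).1.1 _ _)).
      by rewrite addrC lerD.
    apply: (le_trans (le_vals s _ As)).
    apply: (le_trans ((svalP s).1.1 _ _)).
    by rewrite addrC lerD.
  have infq v : inf (vals v) <= q v.
    by apply: (le_trans (le_vals a v Aa)); exact: (svalP a).2.
  exists (exist below_q _ (conj infl infq)) => s As; apply/asboolP => v /=.
  exact: le_vals.
exists m; split=> // m' m'l m'm.
have m'q v : m' v <= q v by exact: le_trans (m'm v) (mq v).
have /mmin/(congr1 sval)/= // :
    below (exist below_q m (conj ml mq)) (exist below_q m' (conj m'l m'q)).
exact/asboolP.
Qed.

(** The minimal functional is taken below [dip q v0] rather than below [q]: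
its value at [- v0] is then at most [- q v0], so that [f v0 = q v0]. *)
Theorem hahn_banach q (v0 : V) : sublinear q ->
  exists f : V -> R, [/\ forall u v, f (u + v) = f u + f v,
    forall t v, f (of_real k t *: v) = t * f v,
    forall v, f v <= q v & f v0 = q v0].
Proof.
move=> ql.
have [m [ml mq mmin]] := minimal_sublinear (sublinear_dip v0 ql).
have mD u v : m (u + v) = m u + m v.
  apply/le_anti; rewrite ml.1 /=.
  have := dip_le v ml u ler01.
  rewrite (mmin _ (sublinear_dip v ml) (dip_le_self v ml)).
  by rewrite of_real1 scale1r mul1r; lra.
have mN v : m (- v) = - m v.
  by have := mD v (- v); rewrite subrr (sublinear0 ml); lra.
have m_le v : m v <= q v by apply: le_trans (mq v) _; exact: dip_le_self.
exists m; split=> // [t v|].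
  have [t0|t0] := leP 0 t; first exact: sublinearZ.
  rewrite -[t]opprK -[of_real k _]opprK scaleNr mN -[- of_real k _]sub0r.
  rewrite -(of_real0 R k) -of_realB sub0r opprK.
  by rewrite (sublinearZ _ ml) ?mulNr// oppr_ge0 ltW.
apply/le_anti; rewrite m_le /= -lerN2 -mN (le_trans (mq _))//.
have := dip_le v0 ql (- v0) ler01.
by rewrite of_real1 scale1r mul1r addNr (sublinear0 ql) sub0r.
Qed.

End hahn_banach.

Section norming_functional.
Variables (R : realType) (k : scalar_kind).
Local Notation K := (scalar_field R k).

(** In the complex case [phi v = f v - i f (i v)]; its real part determines it. *)
Lemma complexification (V : lmodType K) (f : V -> R) :
  (forall u v, f (u + v) = f u + f v) ->
  (forall t v, f (of_real k t *: v) = t * f v) ->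
  exists2 phi : V -> K^o, linear phi & forall v, real_part (phi v) = f v.
Proof.
case: k V f => V f fD fZ.
  by exists f => // a u v; rewrite fD (fZ a).
have fN v : f (- v) = - f v.
  have f0 : f 0 = 0 by have := fD 0 0; rewrite addr0; lra.
  by have := fD v (- v); rewrite subrr f0; lra.
exists (fun v => (f v +i* (- f ('i%C *: v)))%C : R[i]^o) => // -[a b] u v.
have abE (w : V) : (a +i* b)%C *: w = a%:C%C *: w + b%:C%C *: ('i%C *: w).
  by rewrite scalerA -scalerDl; congr (_ *: w); simpc.
have iiN (w : V) : 'i%C *: ('i%C *: w) = - w.
  rewrite scalerA -scaleN1r; congr (_ *: w); by simpc.
have iC (c : R) (w : V) : 'i%C *: (c%:C%C *: w) = c%:C%C *: ('i%C *: w).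
  by rewrite !scalerA mulrC.
apply/eqP; rewrite eq_complex /=; apply/andP; split; apply/eqP.
  by rewrite fD abE fD !fZ; ring.
by rewrite scalerDr abE scalerDr !iC iiN !fD !fZ fN; ring.
Qed.

Lemma unimodular (z : K) : exists2 c : K, `|c| = 1 & c * z = `|z|.
Proof.
have [->|z0] := eqVneq z 0; first by exists 1; rewrite ?normr1 ?mulr0 ?normr0.
exists (`|z| / z); last by rewrite divfK.
by rewrite normrM normrV ?unitfE// normr_id divff// normr_eq0.
Qed.

(** Hahn-Banach bounds only the real part of [phi v]; replacing [v] by a
unimodular multiple for which [phi] is real bounds [phi v] itself. *)
Lemma norming_functional (E : normedModType K) (e : E) :
  exists2 phi : cont_dual E, dual_norm phi <= 1 &
    rnorm e <= rnorm (pairing phi e : K^o).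
Proof.
have qE : sublinear (fun v : E => rnorm v).
  by split=> [u v|t v t0]; [exact: ler_rnormD|rewrite rnorm_of_realZ].
have [f [fD fZ f_le fe]] := hahn_banach e qE.
have [phi phiL phif] := complexification fD fZ.
have phi_le v : rnorm (phi v) <= rnorm v.
  have [c c1 cphi] := unimodular (phi v).
  have phi_lin : phi (c *: v) = c * phi v.
    have := phiL c v 0; rewrite addr0 => ->.
    have := phiL 1 0 0; rewrite scaler0 !addr0 scale1r => /eqP.
    by rewrite -subr_eq0 opprD addNKr oppr_eq0 => /eqP ->; rewrite addr0.
  apply: (@le_trans _ _ (f (c *: v))); first by rewrite -phif phi_lin cphi.
  apply: (le_trans (f_le _)); rewrite rnormZ.
  have -> : rnorm (c : K^o) = 1 by rewrite -(real_part1 R k) -c1.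
  by rewrite mul1r.
have phiC : continuous phi.
  pose g : {linear E -> K^o} :=
    HB.pack phi (GRing.isLinear.Build _ _ _ _ _ phiL).
  apply: (@bounded_linear_continuous K E K^o g).
  apply/linear_boundedP; near=> r => x.
  apply: (@le_trans _ _ `|x|); first by apply: ler_norm_rnorm; exact: phi_le.
  by rewrite ler_peMl//; near: r; exact: nbhs_pinfty_ge.
have phiP : phi \in @cont_linear_form R k E by rewrite inE.
exists (Submod phiP : cont_dual E).
  by apply: dual_norm_le => v v1; rewrite (le_trans (phi_le v)).
by rewrite -fe -phif; exact: ler_real_part_rnorm.
Unshelve. all: by end_near. Qed.

End norming_functional.

(** * Finite sequences in lp: conjugate exponents, concatenation, Hoelder *)

Section lp_norm_theory.
Variable R : realType.
Implicit Types (p q : \bar R) (n : nat) (r s : R).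

Variant conjugate_spec : \bar R -> \bar R -> Prop :=
| ConjugateOne : conjugate_spec 1%:E +oo%E
| ConjugateInfty : conjugate_spec +oo%E 1%:E
| ConjugateFin r s of 1 <= r & 1 <= s & r^-1 + s^-1 = 1 :
    conjugate_spec r%:E s%:E.

Lemma hoelder_conjugate_spec p :
  (1%:E <= p)%E -> conjugate_spec p (hoelder_conjugate p).
Proof.
move=> p1; have := hoelder_conj_ge1 p1.
have : (p^-1 + (hoelder_conjugate p)^-1 = 1)%E.
  apply: hoelder_conjugate_eq1; first by rewrite (lt_le_trans (ltNyr 1)).
  by rewrite gt_eqF// (lt_le_trans _ p1)// lte01.
case: p p1 => [r|_|//]; last first.
  by rewrite hoelder_conjugatey => _ _; exact: ConjugateInfty.
rewrite lee_fin => r1; have r0 : r != 0 by rewrite gt_eqF// (lt_le_trans ltr01).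
case: (eqVneq r 1) => [->|rn1].
  by rewrite hoelder_conjugate1 => _ _; exact: ConjugateOne.
case E : (hoelder_conjugate _) => [s||//].
  rewrite lee_fin => + s1.
  have s0 : s != 0 by rewrite gt_eqF// (lt_le_trans ltr01).
  rewrite !inver (negbTE r0) (negbTE s0) -EFinD => -[rs].
  exact: ConjugateFin.
have /eqP := hoelder_conjugate_eqy E.
by rewrite eqe (negbTE rn1).
Qed.

(** The value [r^(1/p)], with [r^(1/oo) = 1].  For conjugate exponents the two
scales multiply to [r], by [lp_scaleM]. *)
Definition lp_scale p r : R := if p is s%:E%E then r `^ s^-1 else 1.

Lemma lp_scale_gt0 p r : 0 < r -> 0 < lp_scale p r.
Proof. by case: p => //= s r0; exact: powR_gt0. Qed.

Lemma lp_scaleM p r : (1%:E <= p)%E -> 0 < r ->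
  lp_scale (hoelder_conjugate p) r * lp_scale p r = r.
Proof.
move=> /hoelder_conjugate_spec[||s t s1 t1 st] r0 /=.
- by rewrite invr1 powRr1 ?mul1r// ltW.
- by rewrite invr1 powRr1 ?mulr1// ltW.
- by rewrite -powRD addrC st ?oner_eq0// powRr1// ltW.
Qed.

Lemma lp_norm_ge0 p n (a : 'I_n -> R) : 0 <= lp_norm p a.
Proof.
by case: p => //= [r|]; [exact: powR_ge0|exact: bigmax_ge_id].
Qed.

Lemma eq_lp_norm p n (a b : 'I_n -> R) : a =1 b -> lp_norm p a = lp_norm p b.
Proof. by move=> /funext ->. Qed.

Lemma ler_lp_norm p n (a b : 'I_n -> R) : (1%:E <= p)%E ->
  (forall i, 0 <= a i) -> (forall i, a i <= b i) -> lp_norm p a <= lp_norm p b.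
Proof.
move=> + a0 ab; case: p => [r|_|//] /=; last first.
  by apply: le_bigmax2 => i _; exact: ab.
rewrite lee_fin => r1; have r0 : 0 <= r by rewrite (le_trans ler01).
apply: ge0_ler_powR; rewrite ?invr_ge0// ?nnegrE;
  try by apply: sumr_ge0 => i _; exact: powR_ge0.
apply: ler_sum => i _; apply: ge0_ler_powR => //; rewrite nnegrE//.
exact: le_trans (ab i).
Qed.

Lemma lp_normZ p n c (a : 'I_n -> R) : (1%:E <= p)%E -> 0 <= c ->
  (forall i, 0 <= a i) -> lp_norm p (fun i => c * a i) = c * lp_norm p a.
Proof.
move=> + c0 a0; case: p => [r|_|//] /=; last first.
  by rewrite (big_endo (fun x => c * x)) ?mulr0// => x y; rewrite maxr_pMr.
rewrite lee_fin => r1; have r0 : r != 0 by rewrite gt_eqF// (lt_le_trans ltr01).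
under eq_bigr => i _ do rewrite powRM//.
rewrite -mulr_sumr powRM ?powR_ge0//; last first.
  by apply: sumr_ge0 => i _; exact: powR_ge0.
by rewrite -powRrM mulfV// powRr1.
Qed.

Lemma lp_norm_single p (a : 'I_1 -> R) : (1%:E <= p)%E -> 0 <= a ord0 ->
  lp_norm p a = a ord0.
Proof.
move=> + a0; case: p => [r|_|//] /=; last first.
  apply/le_anti; rewrite le_bigmax andbT; apply: bigmax_le => // i _.
  by rewrite ord1.
rewrite lee_fin => r1; have r0 : r != 0 by rewrite gt_eqF// (lt_le_trans ltr01).
by rewrite big_ord1 -powRrM mulfV// powRr1.
Qed.

(** In terms of the p-th powers the norm of a concatenation is additive; stating
the bounds through [lp_scale] gives [p = oo] the same form, where both bounds are
[1]. *)
Lemma lp_norm_cat_le p n m (c : 'I_(n + m) -> R) (s t : R) : (1%:E <= p)%E ->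
  0 <= s -> 0 <= t ->
  lp_norm p (fun i => c (lshift m i)) <= lp_scale p s ->
  lp_norm p (fun i => c (rshift n i)) <= lp_scale p t ->
  lp_norm p c <= lp_scale p (s + t).
Proof.
move=> + s0 t0; case: p => [r|_|//] => [|cl cr] /=; last first.
  apply: bigmax_le => // i _; rewrite -(splitK i).
  by case: (fintype.split i) => j /=; [apply: le_trans cl|apply: le_trans cr];
    exact: (le_bigmax _ (fun j => c _)).
rewrite lee_fin => r1; have r0 : 0 < r by rewrite (lt_le_trans ltr01).
have sum0 (l : nat) (d : 'I_l -> R) : 0 <= \sum_(i < l) d i `^ r.
  by apply: sumr_ge0 => i _; exact: powR_ge0.
have powK (x y : R) : 0 <= x -> 0 <= y -> x `^ r^-1 <= y `^ r^-1 -> x <= y.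
  move=> x0 y0 /(ge0_ler_powR (ltW r0)).
  by rewrite !nnegrE -!powRrM mulVf ?gt_eqF// !powRr1// !powR_ge0; exact.
move=> /powK cl /powK cr; rewrite big_split_ord /=.
apply: ge0_ler_powR; rewrite ?invr_ge0 ?nnegrE ?addr_ge0 ?sum0 ?(ltW r0)//.
by apply: lerD; [apply: (cl _ s0)|apply: (cr _ t0)]; exact: sum0.
Qed.

Lemma lp_norm_eq0 r n (a : 'I_n -> R) i : (forall i, 0 <= a i) ->
  lp_norm r%:E a = 0 -> a i = 0.
Proof.
move=> a0 /= /powR_eq0_eq0/eqP; rewrite psumr_eq0; last first.
  by move=> j _; exact: powR_ge0.
by move=> /allP /(_ i); rewrite mem_index_enum => /(_ isT) /= /eqP/powR_eq0_eq0.
Qed.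

(** For finite conjugate exponents: divide [a] and [b] by their norms and sum the
Young inequality over the indices. *)
Lemma hoelder_sum p n (a b : 'I_n -> R) : (1%:E <= p)%E ->
  (forall i, 0 <= a i) -> (forall i, 0 <= b i) ->
  \sum_(i < n) a i * b i <=
    lp_norm (hoelder_conjugate p) a * lp_norm p b.
Proof.
have sup_one (c d : 'I_n -> R) : (forall i, 0 <= c i) -> (forall i, 0 <= d i) ->
    \sum_(i < n) c i * d i <= lp_norm +oo%E c * lp_norm 1%:E d.
  move=> c0 d0 /=; rewrite invr1 powRr1; last first.
    by apply: sumr_ge0 => i _; exact: powR_ge0.
  rewrite mulr_sumr; apply: ler_sum => i _.
  by rewrite powRr1// ler_wpM2r//; exact: le_bigmax.
move=> /hoelder_conjugate_spec[||r s r1 s1 rs] a0 b0.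
- exact: sup_one.
- by rewrite mulrC; under eq_bigr do rewrite mulrC; exact: sup_one.
have r0 : 0 < r by rewrite (lt_le_trans ltr01).
have s0 : 0 < s by rewrite (lt_le_trans ltr01).
move AE : (lp_norm s%:E a) => A; move BE : (lp_norm r%:E b) => B.
have A_ge0 : 0 <= A by rewrite -AE; exact: lp_norm_ge0.
have B_ge0 : 0 <= B by rewrite -BE; exact: lp_norm_ge0.
have [A0|A_neq0] := eqVneq A 0.
  rewrite A0 mul0r big1// => i _.
  by rewrite (lp_norm_eq0 i a0 (etrans AE A0)) mul0r.
have [B0|B_neq0] := eqVneq B 0.
  rewrite B0 mulr0 big1// => i _.
  by rewrite (lp_norm_eq0 i b0 (etrans BE B0)) mulr0.
have A_gt0 : 0 < A by rewrite lt_neqAle eq_sym A_neq0.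
have B_gt0 : 0 < B by rewrite lt_neqAle eq_sym B_neq0.
have normalized (t : R) (c : 'I_n -> R) C : 0 < t -> (forall i, 0 <= c i) ->
    C = lp_norm t%:E c -> 0 < C -> \sum_(i < n) (c i / C) `^ t = 1.
  move=> t0 c0 CE C0.
  have CtE : C `^ t = \sum_(i < n) c i `^ t.
    rewrite CE /= -powRrM mulVf ?gt_eqF// powRr1//.
    by apply: sumr_ge0 => i _; exact: powR_ge0.
  have Ct0 : 0 < C `^ t by exact: powR_gt0.
  apply: (mulfI (lt0r_neq0 Ct0)); rewrite mulr1 [RHS]CtE mulr_sumr.
  apply: eq_bigr => i _; rewrite -powRM ?divr_ge0 ?(ltW C0)//.
  by rewrite mulrC divfK// gt_eqF.
rewrite mulrC -[leRHS]mul1r -ler_pdivrMr; last exact: mulr_gt0.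
rewrite mulr_suml.
apply: (@le_trans _ _ (\sum_(i < n) ((a i / A) `^ s / s + (b i / B) `^ r / r))).
  apply: ler_sum => i _.
  have -> : a i * b i / (B * A) = (a i / A) * (b i / B) by rewrite invfM; ring.
  by apply: conjugate_powR; rewrite ?divr_ge0 ?(ltW A_gt0) ?(ltW B_gt0)// addrC.
rewrite big_split /= -!mulr_suml (normalized s a A s0 a0 (esym AE) A_gt0).
rewrite (normalized r b B r0 b0 (esym BE) B_gt0).
by rewrite !mul1r addrC rs.
Qed.

End lp_norm_theory.

(** * Bounded operators and their adjoints *)

Section bounded_operators.
Variables (R : realType) (k : scalar_kind).
Local Notation K := (scalar_field R k).
Variables V W : normedModType K.
Implicit Type T : {linear V -> W}.

Lemma bounded_opnorm_has_sup T : bounded_near T (nbhs (0 : V)) ->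
  has_sup [set rnorm (T v) | v in [set v : V | rnorm v <= 1]].
Proof.
move=> Tb; split; first by exists (rnorm (T 0)), 0; rewrite //= rnorm0 ler01.
have /linear_boundedP[M [Mr MP]] := Tb.
have r0 : 0 <= `|M| + 1 by rewrite addr_ge0.
have ltM : M < `|M| + 1 by rewrite ltr_pwDr// real_ler_norm.
exists (real_part (`|M| + 1)) => _ [v /= v1 <-].
have := MP _ ltM v; move=> /le_real_part /le_trans; apply.
rewrite real_partM ?ger0_real// ler_piMr//.
by rewrite -(@real_part0 R k) le_real_part.
Qed.

Lemma ler_opnorm T (v : V) :
  has_sup [set rnorm (T v) | v in [set v : V | rnorm v <= 1]] ->
  rnorm (T v) <= opnorm T * rnorm v.
Proof.
move=> Tsup; have [v0|v0] := eqVneq (rnorm v) 0.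
  by rewrite (rnorm_eq0 v0) linear0 !rnorm0 mulr0.
have {}v0 : 0 < rnorm v by rewrite lt_neqAle eq_sym v0 rnorm_ge0.
rewrite -ler_pdivrMr// mulrC -rnorm_of_realZ ?invr_ge0 ?(ltW v0)// -linearZ.
apply: sup_upper_bound => //; exists (of_real k (rnorm v)^-1 *: v) => //=.
by rewrite rnorm_of_realZ ?invr_ge0 ?(ltW v0)// mulVf ?gt_eqF.
Qed.

Lemma opnorm_ge0 T :
  has_sup [set rnorm (T v) | v in [set v : V | rnorm v <= 1]] -> 0 <= opnorm T.
Proof.
move=> Tsup; apply: (le_trans (rnorm_ge0 (T 0))).
by apply: sup_upper_bound => //; exists 0; rewrite //= rnorm0 ler01.
Qed.

End bounded_operators.

Section dual_theory.
Variables (R : realType) (k : scalar_kind).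
Local Notation K := (scalar_field R k).
Variable E : normedModType K.
Implicit Types (phi psi : cont_dual E) (e : E) (T : {linear E -> E}).

Lemma pairingZr phi a e : pairing phi (a *: e) = a * pairing phi e.
Proof.
have [lphi _] := dualP phi.
pose f : {linear E -> K^o} :=
  HB.pack (submod_val phi) (GRing.isLinear.Build _ _ _ _ _ lphi).
exact: (linearZZ f a e).
Qed.

Lemma pairingBl phi psi e :
  pairing (phi - psi) e = pairing phi e - pairing psi e.
Proof. by []. Qed.

Lemma pairingZl a phi e : pairing (a *: phi) e = a * pairing phi e.
Proof. by []. Qed.

Lemma pairing_suml (I : Type) (s : seq I) (F : I -> cont_dual E) e :
  pairing (\sum_(i <- s) F i) e = \sum_(i <- s) pairing (F i) e.
Proof. by elim/big_rec2: _ => // i y x _ <-. Qed.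

Lemma ler_pairing phi e :
  rnorm (pairing phi e : K^o) <= dual_norm phi * rnorm e.
Proof.
have [lphi _] := dualP phi.
pose f : {linear E -> K^o} :=
  HB.pack (submod_val phi) (GRing.isLinear.Build _ _ _ _ _ lphi).
exact: (@ler_opnorm R k E K^o f e (dual_has_sup phi)).
Qed.

Lemma dual_norm_ge0 phi : 0 <= dual_norm phi.
Proof.
apply: (le_trans (rnorm_ge0 (pairing phi 0 : K^o))).
by apply: dual_norm_ge; rewrite rnorm0 ler01.
Qed.

Section adjoint.
Variable T : {linear E -> E}.
Hypothesis Tb : bounded_near T (nbhs (0 : E)).

Lemma adjoint_subproof phi : (submod_val phi \o T) \in @cont_linear_form R k E.
Proof.
rewrite inE; have [lphi cphi] := dualP phi; split=> [a u v|].
  by rewrite /= linearP lphi.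
move=> x; apply: continuous_comp; last exact: cphi.
exact: bounded_linear_continuous.
Qed.

Definition adjoint phi : cont_dual E := Submod (adjoint_subproof phi).

Lemma pairing_adjoint phi e : pairing (adjoint phi) e = pairing phi (T e).
Proof. by []. Qed.

Lemma dual_dist_adjoint phi psi :
  dual_dist (adjoint phi) (adjoint psi) <= opnorm T * dual_dist phi psi.
Proof.
have Tsup := bounded_opnorm_has_sup Tb.
apply: dual_norm_le => e e1; rewrite pairingBl !pairing_adjoint -pairingBl.
apply: (le_trans (ler_pairing _ _)); rewrite mulrC ler_wpM2r ?dual_norm_ge0//.
apply: (le_trans (ler_opnorm e Tsup)).
by rewrite ler_piMr// opnorm_ge0.
Qed.

Lemma adjoint0 : adjoint 0 = 0.
Proof. by apply: val_inj; apply/funext. Qed.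

End adjoint.

End dual_theory.

(** * Lipschitz maps *)

Section lipschitz_constants.
Variables (R : realType) (X Y : Type) (dX : X -> X -> R) (dY : Y -> Y -> R).
Hypothesis dX_ge0 : forall x y, 0 <= dX x y.
Implicit Type f : X -> Y.

Lemma Lip_attained f x y : lip_bound dX dY f !=set0 ->
  dY (f x) (f y) <= Lip dX dY f * dX x y.
Proof.
move=> f0; rewrite mulrC; apply: le_mul_inf => // L [_ fL].
by rewrite mulrC; exact: fL.
Qed.

Lemma Lip_ge0 f : lip_bound dX dY f !=set0 -> 0 <= Lip dX dY f.
Proof. by move=> f0; apply: lb_le_inf => // L []. Qed.

Lemma Lip_le f L : lip_bound dX dY f L -> Lip dX dY f <= L.
Proof. by move=> fL; apply: ge_inf => //; exists 0 => M []. Qed.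

End lipschitz_constants.

Section lipschitz_maps.
Variables (R : realType) (k : scalar_kind) (X : metricType R) (x0 : X).
Local Notation K := (scalar_field R k).
Local Notation ldual := (@lip_dual R k X x0).
Local Notation LipX g := (Lip mdist (@scalar_dist R k) g).

Lemma scalar_dist_le (g : X -> K) x y : ldual g ->
  scalar_dist (g x) (g y) <= LipX g * mdist x y.
Proof. by move=> [gL _]; apply: Lip_attained => // *; exact: mdist_ge0. Qed.

Lemma lip_dual_ballP (g : X -> K) x y : @lip_dual_ball R k X x0 g ->
  scalar_dist (g x) (g y) <= mdist x y.
Proof.
move=> [gL g1]; apply: (le_trans (scalar_dist_le x y gL)).
by rewrite ler_piMl// mdist_ge0.
Qed.

Lemma lip_dual_ball0 : @lip_dual_ball R k X x0 (fun=> 0 : K).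
Proof.
have lb0 : lip_bound mdist (@scalar_dist R k) (fun _ : X => 0 : K) 0.
  by split=> // x y; rewrite /scalar_dist subrr rnorm0 mul0r.
split; first by split=> //; exists 0.
by rewrite /= (le_trans (Lip_le lb0)).
Qed.

Lemma ler_metricB (x y z : X) : `|mdist x z - mdist y z| <= mdist x y.
Proof.
have := metric_triangle x y z; have := metric_triangle y x z.
by rewrite (metric_sym y x) ler_norml; lra.
Qed.

Lemma dist_mem_lip_dual_ball (y : X) :
  @lip_dual_ball R k X x0 (fun x => of_real k (mdist x y - mdist x0 y)).
Proof.
have lb1 : lip_bound mdist (@scalar_dist R k)
    (fun x => of_real k (mdist x y - mdist x0 y)) 1.
  split=> // u v; rewrite /scalar_dist -of_realB rnorm_of_real mul1r.
  by rewrite opprB addrA subrK ler_metricB.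
split; last exact: Lip_le lb1.
by split; [exists 1|rewrite subrr of_real0].
Qed.

(** For [r <= mdist x0 z] it vanishes at the base point, and on a set of points
at mutual distance at least [r] it is the indicator function of [z]. *)
Definition bump (z : X) (r : R) : X -> K :=
  fun x => of_real k (Num.max 0 (1 - mdist x z / r)).

Lemma bump_self z r : bump z r z = 1.
Proof. by rewrite /bump mdistxx mul0r subr0 max_r// of_real1. Qed.

Lemma bump_far z r x : 0 < r -> r <= mdist x z -> bump z r x = 0.
Proof.
move=> r0 rx; rewrite /bump max_l ?of_real0//.
by rewrite subr_le0 ler_pdivlMr// mul1r.
Qed.

Lemma bump_lip_dual z r : 0 < r -> r <= mdist x0 z -> ldual (bump z r).
Proof.
move=> r0 rx0; split; last exact: bump_far.
exists r^-1; split=> [|x y]; first by rewrite invr_ge0 ltW.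
rewrite /scalar_dist /bump -of_realB rnorm_of_real.
have := ler_metricB x y z; rewrite ler_norml => /andP[l1 l2].
rewrite -(ler_pM2l r0) mulrA mulfV ?gt_eqF// mul1r -[X in X * _]gtr0_norm//.
rewrite -normrM mulrBr !maxr_pMr ?(ltW r0)// !mulr0.
rewrite !mulrBr mulr1 !(mulrC r) !divfK ?gt_eqF//.
rewrite ler_norml !maxEle; apply/andP; split; do 2 case: ifPn; lra.
Qed.

Lemma finite_separation (s : seq X) : exists2 r : R, 0 < r &
  {in s &, forall x y, x != y -> r <= mdist x y}.
Proof.
exists (\big[Num.min/1]_(z <- [seq mdist x y | x <- s, y <- s] | 0 < z) z).
  by apply: lt_bigmin.
move=> x y xs ys xy; have := allpairs_f (fun x y => mdist x y) xs ys.
elim: [seq mdist x y | x <- s, y <- s] => // z t IH; rewrite inE big_cons.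
case/predU1P => [<-|/IH le]; first by rewrite mdist_gt0 xy ge_min lexx.
by case: ifP => // _; rewrite ge_min le orbT.
Qed.

Section dual_valued.
Variable E : normedModType K.
Local Notation maps := (lip_maps x0 E).

Lemma rank_one_subproof (g : X -> K) (gL : ldual g) (phi : cont_dual E) :
  (fun x => g x *: phi) \in @Lip0_dual R k X x0 E.
Proof.
rewrite inE; split; last by rewrite gL.2 scale0r.
exists (LipX g * dual_norm phi); split=> [|x y].
  by rewrite mulr_ge0 ?dual_norm_ge0//; apply: Lip_ge0; exact: gL.1.
rewrite /dual_dist -scalerBl (le_trans (dual_normZ_le _ _))// mulrAC.
by rewrite ler_wpM2r ?dual_norm_ge0//; exact: scalar_dist_le.
Qed.

Definition rank_one (g : X -> K) (gL : ldual g) (phi : cont_dual E) : maps :=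
  Submod (rank_one_subproof gL phi).

Lemma lip_maps_attained (f : maps) : exists2 L, 0 <= L &
  forall x y, dual_dist (submod_val f x) (submod_val f y) <= L * mdist x y.
Proof. by case: f => f /=; rewrite inE => -[[L [L0 fL]] _]; exists L. Qed.

Lemma lip_maps_base (f : maps) : submod_val f x0 = 0.
Proof. by case: f => f /=; rewrite inE => -[]. Qed.

Section pullback.
Variables (h : X -> X) (T : {linear E -> E}).
Hypotheses (hL : Lip0 mdist mdist x0 x0 h) (Tb : bounded_near T (nbhs (0 : E))).

Lemma pullback_subproof (f : maps) :
  (fun x => adjoint Tb (submod_val f (h x))) \in @Lip0_dual R k X x0 E.
Proof.
rewrite inE; split; last by rewrite hL.2 lip_maps_base adjoint0.
have [L L0 fL] := lip_maps_attained f; have [[M [M0 hM]] _] := hL.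
have T0 := opnorm_ge0 (bounded_opnorm_has_sup Tb).
exists (opnorm T * (L * M)); split=> [|x y]; first by rewrite !mulr_ge0.
apply: (le_trans (dual_dist_adjoint Tb _ _)); rewrite -!mulrA ler_wpM2l//.
by apply: (le_trans (fL _ _)); rewrite ler_wpM2l.
Qed.

(** The transpose of the action of [(h, T)] on tensors. *)
Definition pullback (f : maps) : maps := Submod (pullback_subproof f).

End pullback.

(** A finite set of points carries a partition by bumps, so on it [f] has the
values of a finite sum of rank-one maps.  The base point is left out of [zs],
since no function vanishing there can be a bump around it; nothing is lost, as
[f] vanishes there too. *)
Lemma lip_maps_interpolation (f : maps) (s : seq X) :
  exists zs : seq X, exists g : X -> X -> K,
  (forall z, z \in zs -> ldual (g z)) /\
  {in s, forall x, submod_val f x = \sum_(z <- zs) g z x *: submod_val f z}.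
Proof.
have [r r0 rP] := finite_separation (x0 :: s).
exists [seq z <- undup s | z != x0], (fun z => bump z r); split=> [z|x xs].
  rewrite mem_filter mem_undup => /andP[zx0 zs].
  by apply: bump_lip_dual => //; rewrite rP ?inE ?eqxx ?zs ?orbT// eq_sym.
have far z : z \in s -> z != x -> bump z r x = 0.
  by move=> zs zx; rewrite bump_far// rP ?inE ?zs ?xs ?orbT// eq_sym.
have [xx0|xx0] := eqVneq x x0.
  rewrite xx0 lip_maps_base big1_seq// => z /andP[_].
  rewrite mem_filter mem_undup => /andP[zx0 zs].
  have -> : bump z r x0 = 0 by rewrite -xx0 far ?xx0.
  exact: scale0r.
rewrite (bigD1_seq x) ?filter_uniq ?undup_uniq ?mem_filter ?xx0 ?mem_undup//=.
rewrite bump_self scale1r big1_seq ?addr0// => z /andP[zx].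
by rewrite mem_filter mem_undup => /andP[_ zs]; rewrite far ?scale0r.
Qed.

End dual_valued.
End lipschitz_maps.

(** * The weak norm *)

Section weak_norm.
Variables (R : realType) (k : scalar_kind) (X : metricType R) (x0 : X).
Local Notation K := (scalar_field R k).
Local Notation ldual := (@lip_dual R k X x0).
Local Notation ball := (@lip_dual_ball R k X x0).
Local Notation LipX g := (Lip mdist (@scalar_dist R k) g).

Lemma scaled_dist_ge0 (c : R) (a b : K) : 0 < c -> 0 <= c * scalar_dist a b.
Proof. by move=> c0; rewrite mulr_ge0 ?rnorm_ge0 ?ltW. Qed.

Variable q : \bar R.
Hypothesis q1 : (1%:E <= q)%E.
Variable n : nat.
Implicit Types (l : 'I_n -> R) (x y : 'I_n -> X) (g : X -> K).
Local Notation weak := (lip_weak_norm k x0 q).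

Lemma ler_weak_norm l x y g : (forall i, 0 < l i) -> ball g ->
  lp_norm q (fun i => l i * scalar_dist (g (x i)) (g (y i))) <= weak l x y.
Proof.
move=> l0 gb; apply: sup_upper_bound; last by exists g.
split.
  by exists (lp_norm q (fun i => l i * scalar_dist (g (x i)) (g (y i)))), g.
exists (lp_norm q (fun i => l i * mdist (x i) (y i))) => _ [g' g'b <-].
apply: ler_lp_norm => // i; first exact: scaled_dist_ge0.
by rewrite ler_pM2l//; exact: (lip_dual_ballP _ _ g'b).
Qed.

Lemma weak_norm_le l x y M :
  (forall g, ball g ->
    lp_norm q (fun i => l i * scalar_dist (g (x i)) (g (y i))) <= M) ->
  weak l x y <= M.
Proof.
move=> leM; apply: ge_sup; last by move=> _ [g gb <-]; exact: leM.
by eexists; exists (fun=> 0); first exact: (@lip_dual_ball0 R k X x0).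
Qed.

Lemma weak_norm_ge0 l x y : (forall i, 0 < l i) -> 0 <= weak l x y.
Proof.
move=> l0; have := ler_weak_norm x y l0 (@lip_dual_ball0 R k X x0).
by apply: le_trans; exact: lp_norm_ge0.
Qed.

Lemma scaled_lip_bound g (c : R) : 0 <= c -> ldual g ->
  lip_bound mdist (@scalar_dist R k) (fun u => of_real k c * g u) (c * LipX g).
Proof.
move=> c0 gL; split=> [|u v].
  by rewrite mulr_ge0//; apply: Lip_ge0; exact: gL.1.
rewrite /scalar_dist -mulrBr rnormM rnorm_of_real ger0_norm// -mulrA.
by rewrite ler_wpM2l//; exact: (scalar_dist_le _ _ gL).
Qed.

(** If [Lip g > 0], normalize [g] into the unit ball.  If [Lip g = 0], then [g] is
constant and the left-hand side vanishes. *)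
Lemma ler_lip_weak_norm l x y g : (forall i, 0 < l i) -> ldual g ->
  lp_norm q (fun i => l i * scalar_dist (g (x i)) (g (y i))) <=
  LipX g * weak l x y.
Proof.
move=> l0 gL; have := Lip_ge0 gL.1.
rewrite le_eqVlt => /predU1P[Lg0|Lg0].
  apply: (@le_trans _ _
    (lp_norm q (fun i => LipX g * (l i * mdist (x i) (y i))))).
    apply: ler_lp_norm => // i; first exact: scaled_dist_ge0.
    by rewrite mulrCA ler_pM2l//; exact: (scalar_dist_le _ _ gL).
  rewrite lp_normZ// -?Lg0 ?mul0r// => i.
  by rewrite mulr_ge0 ?mdist_ge0 ?ltW.
have Lb := scaled_lip_bound (ltW (eqbRL (invr_gt0 _) Lg0)) gL.
set c := (LipX g)^-1 in Lb; pose g' u := of_real k c * g u.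
have g'b : ball g'.
  split; last by apply: (le_trans (Lip_le Lb)); rewrite mulVf// gt_eqF.
  by split; [eexists; exact: Lb|rewrite /g' gL.2 mulr0].
apply: le_trans (ler_wpM2l (ltW Lg0) (ler_weak_norm x y l0 g'b)).
rewrite -lp_normZ ?(ltW Lg0)// => [|i]; last exact: scaled_dist_ge0.
apply: ler_lp_norm => // i; first exact: scaled_dist_ge0.
rewrite /scalar_dist -mulrBr rnormM rnorm_of_real.
rewrite ger0_norm ?invr_ge0 ?(ltW Lg0)//.
by rewrite [leRHS]mulrCA [_ * (c * _)]mulrA mulfV ?gt_eqF// mul1r.
Qed.

Lemma weak_normZ_le l x y (t : R) : 0 < t -> (forall i, 0 < l i) ->
  weak (fun i => t * l i) x y <= t * weak l x y.
Proof.
move=> t0 l0; apply: weak_norm_le => g gb.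
under eq_fun do rewrite -mulrA.
rewrite lp_normZ ?(ltW t0)// => [|i]; last exact: scaled_dist_ge0.
by rewrite ler_pM2l// ler_weak_norm.
Qed.

End weak_norm.

(** * Representations of tensors *)

Section cat_families.
Variables (T : Type) (n m : nat) (a : 'I_n -> T) (b : 'I_m -> T).

Definition cat_fam : 'I_(n + m) -> T := fun i =>
  match fintype.split i with inl j => a j | inr j => b j end.

Lemma cat_fam_lshift i : cat_fam (lshift m i) = a i.
Proof. by rewrite /cat_fam (unsplitK (inl i)). Qed.

Lemma cat_fam_rshift i : cat_fam (rshift n i) = b i.
Proof. by rewrite /cat_fam (unsplitK (inr i)). Qed.

End cat_families.

Section tensors.
Variables (R : realType) (k : scalar_kind) (X : metricType R) (x0 : X).
Local Notation K := (scalar_field R k).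
Variable E : normedModType K.
Local Notation tensor := (lip_tensor x0 E).
Local Notation delta := (lip_delta x0).
Implicit Types (u v : tensor) (f : lip_maps x0 E) (p : \bar R).

Definition tensor_eval u f : K := submod_val (submod_val u) f.

Lemma tensor_eval_delta n (x y : 'I_n -> X) (e : 'I_n -> E) f :
  tensor_eval (\sum_(i < n) delta (x i) (y i) (e i)) f =
  \sum_(i < n) pairing (submod_val f (x i) - submod_val f (y i)) (e i).
Proof.
have -> : \sum_(i < n) delta (x i) (y i) (e i) =
    \sum_(i < n) 1 *: delta (x i) (y i) (e i).
  by apply: eq_bigr => i _; rewrite scale1r.
rewrite [LHS]lip_tensor_sumE.
by apply: eq_bigr => i _; rewrite mul1r.
Qed.

Lemma pairing_rank_one (g : X -> K) (gL : lip_dual x0 g) (phi : cont_dual E)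
    x y e :
  pairing (submod_val (rank_one gL phi) x - submod_val (rank_one gL phi) y) e =
  (g x - g y) * pairing phi e.
Proof. by rewrite pairingBl !pairingZl mulrBl. Qed.

Definition represents n (l : 'I_n -> R) (x y : 'I_n -> X) (e : 'I_n -> E) u :=
  [/\ (0 < n)%N, forall i, 0 < l i &
      u = \sum_(i < n) of_real k (l i) *: delta (x i) (y i) (e i)].

Lemma deltaZ (a : K) x y (e : E) : delta x y (a *: e) = a *: delta x y e.
Proof. by apply: lip_tensor_ext => f; exact: pairingZr. Qed.

Lemma representsZ (a : K) n l x y e u : @represents n l x y e u ->
  represents l x y (fun i => a *: e i) (a *: u).
Proof.
move=> [n0 l0 ->]; split=> //; rewrite scaler_sumr.
by apply: eq_bigr => i _; rewrite deltaZ !scalerA mulrC.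
Qed.

Lemma represents_rescale (t : R) n l x y e u :
  0 < t -> @represents n l x y e u ->
  represents (fun i => t * l i) x y (fun i => of_real k t^-1 *: e i) u.
Proof.
move=> t0 [n0 l0 ->]; split=> [//|i|]; first by rewrite mulr_gt0.
apply: eq_bigr => i _; rewrite deltaZ scalerA -of_realM.
by rewrite mulrAC mulfV ?gt_eqF// mul1r.
Qed.

Lemma represents_cat n l x y e u m l' x' y' e' v :
  @represents n l x y e u -> @represents m l' x' y' e' v ->
  represents (cat_fam l l') (cat_fam x x') (cat_fam y y') (cat_fam e e')
    (u + v).
Proof.
move=> [n0 l0 ->] [m0 l'0 ->]; split=> [|i|].
- by rewrite addn_gt0 n0.
- by rewrite /cat_fam; case: fintype.split.
- rewrite big_split_ord /=; congr (_ + _); apply: eq_bigr => i _.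
    by rewrite !cat_fam_lshift.
  by rewrite !cat_fam_rshift.
Qed.

Lemma represents_delta x y (e : E) :
  @represents 1 (fun=> 1) (fun=> x) (fun=> y) (fun=> e) (delta x y e).
Proof. by split=> //; rewrite big_ord1 of_real1 scale1r. Qed.

(** Scalar coefficients are absorbed in the vectors [e i]; the empty combination
is written as [0 *: delta x0 x0 0], since a representation has at least one
term. *)
Lemma representable u : exists n l x y e, @represents n l x y e u.
Proof.
have : submod_val u \in lin_span (@delta_forms R k X x0 E) by case: (u).
rewrite inE => -[n [c [a [aP uE]]]].
have /choice[xye xyeE] : forall i, exists t : X * X * E,
    a i = delta_form x0 t.1.1 t.1.2 t.2.
  by move=> i; have [x [y [e ->]]] := aP i; exists (x, y, e).
have {}uE : u = \sum_(i < n) c i *: delta (xye i).1.1 (xye i).1.2 (xye i).2.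
  apply: val_inj; rewrite /= uE submod_val_sum; apply: eq_bigr => i _.
  by rewrite xyeE.
case: n c a aP xye xyeE uE => [|n] c a aP xye _ uE.
  have u0 : u = 0 *: delta x0 x0 0 by rewrite scale0r uE big_ord0.
  exists 1%N; do 4 eexists; rewrite u0; apply: representsZ.
  exact: represents_delta.
exists n.+1, (fun=> 1), (fun i => (xye i).1.1), (fun i => (xye i).1.2),
  (fun i => c i *: (xye i).2).
split=> //; rewrite uE; apply: eq_bigr => i _.
by rewrite deltaZ of_real1 scale1r.
Qed.

(** Rank-one maps separate tensors: on the points occurring in [u], any [f] is a
finite sum of rank-one maps. *)
Lemma tensor_eq0 u :
  (forall (g : X -> K) (gL : lip_dual x0 g) (phi : cont_dual E),
     tensor_eval u (rank_one gL phi) = 0) -> u = 0.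
Proof.
move=> u0; apply: lip_tensor_ext => f; rewrite -[RHS]/(0 : K).
have [n [l [x [y [e [_ _ uE]]]]]] := representable u.
have [zs [g [gL fE]]] :=
  lip_maps_interpolation f
    ([seq x i | i <- enum 'I_n] ++ [seq y i | i <- enum 'I_n]).
have xE i : submod_val f (x i) = \sum_(z <- zs) g z (x i) *: submod_val f z.
  by apply: fE; rewrite mem_cat map_f ?mem_enum.
have yE i : submod_val f (y i) = \sum_(z <- zs) g z (y i) *: submod_val f z.
  by apply: fE; rewrite mem_cat orbC map_f ?mem_enum.
rewrite uE lip_tensor_sumE.
under eq_bigr => i _.
  rewrite xE yE -sumrB pairing_suml mulr_sumr; over.
rewrite exchange_big /= big1_seq// => z /andP[_ /gL zL].
rewrite -[RHS](u0 _ zL (submod_val f z)) /tensor_eval uE lip_tensor_sumE.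
by apply: eq_bigr => i _; rewrite pairing_rank_one mulrBl.
Qed.

End tensors.

(** * The nuclear norm *)

Section nuclear.
Variables (R : realType) (k : scalar_kind) (X : metricType R) (x0 : X).
Local Notation K := (scalar_field R k).
Variables (E : normedModType K) (p : \bar R).
Hypothesis p1 : (1%:E <= p)%E.
Let q := hoelder_conjugate p.
Local Notation tensor := (lip_tensor x0 E).
Local Notation delta := (lip_delta x0).
Local Notation nuclear := (nuclear_norm x0 E p).
Local Notation LipX g := (Lip mdist (@scalar_dist R k) g).
Local Notation weak := (lip_weak_norm k x0 q).
Local Notation strong e := (lp_norm p (fun i => rnorm (e i))).
Implicit Types u v : tensor.

Let q1 : (1%:E <= q)%E. Proof. exact: hoelder_conj_ge1. Qed.

Lemma nuclear_norm_le u n l x y e : @represents R k X x0 E n l x y e u ->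
  nuclear u <= weak l x y * strong e.
Proof.
move=> [n0 l0 uE]; apply: ge_inf; last by exists n, l, x, y, e; split.
exists 0 => _ [m [l' [x' [y' [e' [_ l'0 _ ->]]]]]].
by rewrite mulr_ge0 ?lp_norm_ge0// weak_norm_ge0.
Qed.

Lemma le_nuclear_norm u (c M : R) : 0 <= c ->
  (forall n l x y e, @represents R k X x0 E n l x y e u ->
    M <= c * (weak l x y * strong e)) ->
  M <= c * nuclear u.
Proof.
move=> c0 leM; apply: le_mul_inf => //.
  have [n [l [x [y [e [n0 l0 uE]]]]]] := representable u.
  by eexists; exists n, l, x, y, e; split.
by move=> _ [n [l [x [y [e [n0 l0 uE ->]]]]]]; apply: leM; split.
Qed.

Lemma nuclear_norm_ge0 u : 0 <= nuclear u.
Proof.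
rewrite -[leRHS]mul1r; apply: le_nuclear_norm => // n l x y e [_ l0 _].
by rewrite mul1r mulr_ge0 ?lp_norm_ge0// weak_norm_ge0.
Qed.

Lemma nuclear_norm_delta_le x y (e : E) :
  nuclear (delta x y e) <= mdist x y * rnorm e.
Proof.
apply: (le_trans (nuclear_norm_le (represents_delta x0 x y e))).
rewrite lp_norm_single ?rnorm_ge0// ler_wpM2r ?rnorm_ge0//.
apply: weak_norm_le => g gb; rewrite lp_norm_single//= mul1r ?rnorm_ge0//.
exact: (lip_dual_ballP _ _ gb).
Qed.

Lemma nuclear_normZ_le (a : K) u :
  nuclear (a *: u) <= rnorm (a : K^o) * nuclear u.
Proof.
apply: le_nuclear_norm => [|n l x y e uR]; first exact: rnorm_ge0.
apply: (le_trans (nuclear_norm_le (representsZ a uR))).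
under [X in lp_norm _ X]eq_fun do rewrite rnormZ.
rewrite lp_normZ ?rnorm_ge0// => [|i]; last exact: rnorm_ge0.
by rewrite mulrCA.
Qed.

Lemma nuclear_normZ (a : K) u : nuclear (a *: u) = rnorm (a : K^o) * nuclear u.
Proof.
apply/le_anti; rewrite nuclear_normZ_le /=.
have [->|a0] := eqVneq a 0; first by rewrite rnorm0 mul0r nuclear_norm_ge0.
have := nuclear_normZ_le a^-1 (a *: u).
rewrite scalerA mulVf// scale1r.
move=> /(ler_wpM2l (rnorm_ge0 (a : K^o))) /le_trans; apply.
rewrite mulrA -rnormM mulfV//.
have := rnorm_of_real k (1 : R).
by rewrite of_real1 normr1 => ->; rewrite mul1r.
Qed.

(** Replacing [l] by [t l] and [e] by [e / t] multiplies the weak norm by [t] and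
the strong norm by [1 / t], without changing their product, which is below
[s = lp_scale q s * lp_scale p s]; a suitable [t] puts each of them below its
scale. *)
Lemma nuclear_norm_lt u (s : R) : nuclear u < s ->
  exists n l x y e, [/\ @represents R k X x0 E n l x y e u,
    weak l x y <= lp_scale q s & strong e <= lp_scale p s].
Proof.
move=> us; have s0 : 0 < s by rewrite (le_lt_trans (nuclear_norm_ge0 u)).
have [n [l [x [y [e [uR lt_s]]]]]] : exists n l x y e,
    @represents R k X x0 E n l x y e u /\ weak l x y * strong e < s.
  have [|r [n [l [x [y [e [n0 l0 uE ->]]]]]] lt_s] := inf_lt _ us.
    have [n [l [x [y [e [n0 l0 uE]]]]]] := representable u.
    by eexists; exists n, l, x, y, e; split.
  by exists n, l, x, y, e; split.
have l0 : forall i, 0 < l i by have [] := uR.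
have qs0 := lp_scale_gt0 q s0; have ps0 := lp_scale_gt0 p s0.
have N0 : 0 <= strong e by exact: lp_norm_ge0.
have rescaled t : 0 < t -> t * weak l x y <= lp_scale q s ->
    strong e <= t * lp_scale p s -> exists n l x y e,
    [/\ @represents R k X x0 E n l x y e u, weak l x y <= lp_scale q s &
      strong e <= lp_scale p s].
  move=> t0 tW tN.
  exists n, (fun i => t * l i), x, y, (fun i => of_real k t^-1 *: e i).
  split; first exact: represents_rescale.
    by apply: le_trans tW; exact: weak_normZ_le.
  under [X in lp_norm _ X]eq_fun do
    rewrite rnorm_of_realZ ?invr_ge0 ?(ltW t0)//.
  rewrite lp_normZ ?invr_ge0 ?(ltW t0)// => [|i]; last exact: rnorm_ge0.
  by rewrite ler_pdivrMl.
have : 0 <= weak l x y by exact: weak_norm_ge0.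
rewrite le_eqVlt => /predU1P[W0|W0].
  (* The weak norm vanishes, so any [t] large enough for the strong norm will do. *)
  apply: (rescaled (1 + strong e / lp_scale p s)).
  - by rewrite ltr_pwDl// divr_ge0// ltW.
  - by rewrite -W0 mulr0 ltW.
  - by rewrite mulrDl mul1r divfK ?gt_eqF// lerDr ltW.
(* This [t] makes the weak norm equal to its scale. *)
apply: (rescaled (lp_scale q s / weak l x y)).
- by rewrite divr_gt0.
- by rewrite divfK// gt_eqF.
- by rewrite mulrAC lp_scaleM// ler_pdivlMr// mulrC ltW.
Qed.

Lemma ler_nuclear_normD u v : nuclear (u + v) <= nuclear u + nuclear v.
Proof.
apply/ler_addgt0Pr => eps eps0.
have e20 : 0 < eps / 2 by rewrite divr_gt0.
move sE : (nuclear u + eps / 2) => s; move tE : (nuclear v + eps / 2) => t.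
have -> : nuclear u + nuclear v + eps = s + t by rewrite -sE -tE; lra.
have s0 : 0 < s by rewrite -sE ltr_wpDl// nuclear_norm_ge0.
have t0 : 0 < t by rewrite -tE ltr_wpDl// nuclear_norm_ge0.
have [|n [l [x [y [e [uR uW uN]]]]]] := @nuclear_norm_lt u s.
  by rewrite -sE ltrDl.
have [|m [l' [x' [y' [e' [vR vW vN]]]]]] := @nuclear_norm_lt v t.
  by rewrite -tE ltrDl.
have [_ l0 _] := uR; have [_ l'0 _] := vR.
apply: (le_trans (nuclear_norm_le (represents_cat uR vR))).
rewrite -[leRHS](lp_scaleM p1) ?addr_gt0//.
apply: ler_pM; rewrite ?lp_norm_ge0//.
- by apply: weak_norm_ge0 => // i; rewrite /cat_fam; case: fintype.split.
- apply: weak_norm_le => g gb.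
  apply: lp_norm_cat_le (ltW s0) (ltW t0) _ _ => //.
    rewrite (eq_lp_norm _ (b := fun i => l i * scalar_dist (g (x i)) (g (y i)))).
      by apply: le_trans uW; exact: ler_weak_norm.
    by move=> i; rewrite !cat_fam_lshift.
  rewrite (eq_lp_norm _ (b := fun i => l' i * scalar_dist (g (x' i)) (g (y' i)))).
    by apply: le_trans vW; exact: ler_weak_norm.
  by move=> i; rewrite !cat_fam_rshift.
- apply: lp_norm_cat_le (ltW s0) (ltW t0) _ _ => //.
    rewrite (eq_lp_norm _ (b := fun i => rnorm (e i)))// => i.
    by rewrite cat_fam_lshift.
  rewrite (eq_lp_norm _ (b := fun i => rnorm (e' i)))// => i.
  by rewrite cat_fam_rshift.
Qed.

(** The quantitative form of dualizability: the left-hand side depends on [u]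
alone, so Hoelder's inequality may be applied to any representation of [u]. *)
Lemma tensor_eval_rank_one_le (g : X -> K) (gL : lip_dual x0 g)
    (phi : cont_dual E) u :
  rnorm (tensor_eval u (rank_one gL phi) : K^o) <=
  LipX g * dual_norm phi * nuclear u.
Proof.
have Lg0 : 0 <= LipX g by apply: Lip_ge0; exact: gL.1.
have phi0 := dual_norm_ge0 phi.
apply: le_nuclear_norm => [|n l x y e [_ l0 ->]]; first exact: mulr_ge0.
rewrite /tensor_eval lip_tensor_sumE.
apply: (le_trans (ler_rnorm_sum (V := K^o) _)).
apply: (@le_trans _ _ (\sum_(i < n)
    (l i * scalar_dist (g (x i)) (g (y i))) * (dual_norm phi * rnorm (e i)))).
  apply: ler_sum => i _.
  rewrite pairing_rank_one !rnormM rnorm_of_real gtr0_norm// mulrA.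
  by rewrite ler_wpM2l ?scaled_dist_ge0// ler_pairing.
apply: (le_trans (hoelder_sum p1 _ _)) => [i|i|].
- exact: scaled_dist_ge0.
- by rewrite mulr_ge0 ?rnorm_ge0.
rewrite lp_normZ// => [|i]; last exact: rnorm_ge0.
rewrite mulrACA; apply: ler_wpM2r; last exact: ler_lip_weak_norm.
by apply: mulr_ge0 => //; exact: lp_norm_ge0.
Qed.

Lemma nuclear_norm_eq0 u : nuclear u = 0 -> u = 0.
Proof.
move=> u0; apply: tensor_eq0 => g gL phi; apply: (@rnorm_eq0 R k K^o).
apply/le_anti; rewrite rnorm_ge0 andbT.
by have := tensor_eval_rank_one_le gL phi u; rewrite u0 mulr0.
Qed.

Lemma nuclear_norm_dualizable : is_dualizable nuclear.
Proof.
move=> g phi n x y e gL.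
have := tensor_eval_rank_one_le gL phi (\sum_(i < n) delta (x i) (y i) (e i)).
rewrite tensor_eval_delta; under eq_bigr do rewrite pairing_rank_one.
exact.
Qed.

(** For the lower bound, dualizability is applied with [n = 1] to the distance
function [d(., y) - d(x0, y)] and to a functional norming [e]. *)
Lemma nuclear_norm_delta x y (e : E) :
  nuclear (delta x y e) = mdist x y * rnorm e.
Proof.
apply/le_anti; rewrite nuclear_norm_delta_le /=.
have [phi phi1 phie] := norming_functional e.
have [gL g1] := @dist_mem_lip_dual_ball R k X x0 y.
have := @nuclear_norm_dualizable _ phi 1%N (fun=> x) (fun=> y) (fun=> e) gL.
rewrite !big_ord1 rnormM -of_realB rnorm_of_real mdistxx.
have -> : mdist x y - mdist x0 y - (0 - mdist x0 y) = mdist x y by lra.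
rewrite ger0_norm ?mdist_ge0// => le1.
apply: (@le_trans _ _ (mdist x y * rnorm (pairing phi e : K^o))).
  by rewrite ler_wpM2l// mdist_ge0.
apply: (le_trans le1); rewrite ler_piMl ?nuclear_norm_ge0//.
by rewrite mulr_ile1// ?dual_norm_ge0//; apply: Lip_ge0; exact: gL.1.
Qed.

(** A representation of [u] is carried by [(h, T)] to one of the image tensor: to
compare it with the image of the given representation, evaluate both at [f] and
read the result as an evaluation of [u] at [pullback hL Tb f]. *)
Lemma nuclear_norm_uniform : is_uniform nuclear.
Proof.
move=> h T n x y e hL Tb; have Tsup := bounded_opnorm_has_sup Tb.
have Lh0 : 0 <= Lip mdist mdist h by apply: Lip_ge0; exact: hL.1.
have T0 := opnorm_ge0 Tsup.
apply: le_nuclear_norm => [|m l x' y' e' [m0 l0 uE]]; first exact: mulr_ge0.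
have vR : represents l (h \o x') (h \o y') (T \o e')
    (\sum_(i < n) delta (h (x i)) (h (y i)) (T (e i))).
  split=> //; apply: lip_tensor_ext => f.
  rewrite lip_tensor_sumE -[LHS]/(tensor_eval _ f) tensor_eval_delta.
  have := tensor_eval_delta x y e (pullback hL Tb f).
  by rewrite uE /tensor_eval lip_tensor_sumE => <-.
apply: (le_trans (nuclear_norm_le vR)); rewrite mulrACA.
apply: ler_pM; rewrite ?lp_norm_ge0//; first exact: weak_norm_ge0.
  apply: weak_norm_le => g [gL g1].
  have ghb : lip_bound mdist (@scalar_dist R k) (g \o h) (Lip mdist mdist h).
    split=> // a b /=; apply: (le_trans (lip_dual_ballP _ _ (conj gL g1))).
    by apply: Lip_attained => //; [exact: mdist_ge0|exact: hL.1].
  have ghL : lip_dual x0 (g \o h).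
    by split; [exists (Lip mdist mdist h)|rewrite /= hL.2 gL.2].
  apply: (le_trans (ler_lip_weak_norm q1 x' y' l0 ghL)).
  by rewrite ler_wpM2r ?weak_norm_ge0//; exact: Lip_le.
rewrite -lp_normZ// => [|i]; last exact: rnorm_ge0.
by apply: ler_lp_norm => // i; rewrite ?rnorm_ge0//= ler_opnorm.
Qed.

End nuclear.

Theorem theorem7p2 (R : realType) (k : scalar_kind) (X : metricType R) (x0 : X)
    (E : completeNormedModType (scalar_field R k)) (p : \bar R) :
  (1%:E <= p)%E ->
  [/\ is_lip_cross_norm (nuclear_norm x0 E p),
      is_dualizable (nuclear_norm x0 E p) &
      is_uniform (nuclear_norm x0 E p)].
Proof.
move=> p1; split; [split; [split|]| |].
- exact: nuclear_norm_ge0.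
- exact: nuclear_norm_eq0.
- exact: nuclear_normZ.
- exact: ler_nuclear_normD.
- exact: nuclear_norm_delta.
- exact: nuclear_norm_dualizable.
- exact: nuclear_norm_uniform.
Qed.
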